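(* Let $D\subseteq\mathbb{C}$ be open and convex and let $f:D\to\mathbb{C}$ be a function of class $C^1$. Assume that there exist $w_1,w_2\in\mathbb{C}$ such that $\operatorname{Re} w_1\operatorname{Im} w_2\neq \operatorname{Re} w_2\operatorname{Im} w_1$ and for all $z\in D$ the following condition holds: $$\operatorname{Re}\left(\frac{\partial f}{\partial z}(z)w_1+\frac{\partial f}{\partial \overline{z}}(z)\overline{w_1}\right)+\operatorname{Im}\left(\frac{\partial f}{\partial z}(z)w_2+\frac{\partial f}{\partial \overline{z}}(z)\overline{w_2}\right)> \left|\frac{\partial f}{\partial z}(z)(w_2-iw_1)+\frac{\partial f}{\partial \overline{z}}(z)\overline{(w_2+iw_1)}\right|.$$ Then $f$ is injective.
   Context: Writing $f(z)=u(x,y)+iv(x,y)$ for $z=x+iy\in D$, class $C^1$ is meant in the real sense, i.e. $(u,v)$ is continuously differentiable as a function of $(x,y)\in D\subseteq\mathbb{R}^2$. Moreover $\frac{\partial f}{\partial x}=u'_x+iv'_x$, $\frac{\partial f}{\partial y}=u'_y+iv'_y$, $\frac{\partial f}{\partial z}=\frac12\left(\frac{\partial f}{\partial x}-i\frac{\partial f}{\partial y}\right)$ and $\frac{\partial f}{\partial \overline{z}}=\frac12\left(\frac{\partial f}{\partial x}+i\frac{\partial f}{\partial y}\right)$. *)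

(* Defs.v *)
From Stdlib Require Import Reals.
From Coquelicot Require Import Coquelicot.

Local Open Scope C_scope.

Definition convex (D : C -> Prop) : Prop :=
  forall (z1 z2 : C) (t : R), D z1 -> D z2 -> (0 <= t <= 1)%R ->
    D (RtoC (1 - t) * z1 + RtoC t * z2).

(* Partial derivatives of a real function of z = x + i y, with respect to the
   real variables x and y. *)
Definition ex_partial_x (g : C -> R) (z : C) : Prop :=
  ex_derive (fun x : R => g (x, Im z)) (Re z).

Definition ex_partial_y (g : C -> R) (z : C) : Prop :=
  ex_derive (fun y : R => g (Re z, y)) (Im z).

Definition partial_x (g : C -> R) (z : C) : R :=
  Derive (fun x : R => g (x, Im z)) (Re z).

Definition partial_y (g : C -> R) (z : C) : R :=
  Derive (fun y : R => g (Re z, y)) (Im z).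

(* Meant for an open set D: existence, value and continuity of the partial
   derivatives at points of D then depend only on the restriction of g to D. *)
Definition real_class_C1 (D : C -> Prop) (g : C -> R) : Prop :=
  forall z : C, D z ->
    ex_partial_x g z /\ ex_partial_y g z /\
    continuous (partial_x g) z /\ continuous (partial_y g) z.

Definition re_part (f : C -> C) (z : C) : R := Re (f z).
Definition im_part (f : C -> C) (z : C) : R := Im (f z).

Definition class_C1 (D : C -> Prop) (f : C -> C) : Prop :=
  real_class_C1 D (re_part f) /\ real_class_C1 D (im_part f).

Definition d_dx (f : C -> C) (z : C) : C :=
  RtoC (partial_x (re_part f) z) + Ci * RtoC (partial_x (im_part f) z).

Definition d_dy (f : C -> C) (z : C) : C :=
  RtoC (partial_y (re_part f) z) + Ci * RtoC (partial_y (im_part f) z).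

Definition d_dz (f : C -> C) (z : C) : C :=
  RtoC (1 / 2) * (d_dx f z - Ci * d_dy f z).

Definition d_dzbar (f : C -> C) (z : C) : C :=
  RtoC (1 / 2) * (d_dx f z + Ci * d_dy f z).

Definition injective_on (D : C -> Prop) (f : C -> C) : Prop :=
  forall z1 z2 : C, D z1 -> D z2 -> f z1 = f z2 -> z1 = z2.

(* Main.v *)
(** Write [z2 - z1 = h1 w1 + h2 w2].  With [p_j + i q_j] the derivative of [f]
    in the direction [w_j], the hypothesis reads
    [p1 + q2 > |(p2 + q1) + i (q2 - p1)|], i.e. the quadratic form
    [p1 h1^2 + (p2 + q1) h1 h2 + q2 h2^2] is positive definite.  This form is
    the derivative of [h1 Re f + h2 Im f] along the segment from [z1] to [z2],
    so by the mean value theorem that function takes distinct values at the two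
    ends. *)
Require Import Defs.
From Stdlib Require Import Reals Psatz.
From Coquelicot Require Import Coquelicot.

Local Open Scope R_scope.

(** The chain rule along a slanted segment needs joint differentiability, not just partial
    derivatives. Openness of [D] gives the x-partial on a whole neighbourhood; its continuity at the
    point then makes the linear approximation uniform in y. *)
Lemma C1_differentiable (D : C -> Prop) (g : C -> R) (x y : R) :
  open D -> real_class_C1 D g -> D (x, y) ->
  differentiable_pt_lim (fun u v => g (u, v)) x y
    (partial_x g (x, y)) (partial_y g (x, y)).
Proof.
intros HD Hg Hz.
apply filterdiff_differentiable_pt_lim.
apply (is_derive_filterdiff (fun u v => g (u, v)) x y
  (fun u v => partial_x g (u, v)) (partial_y g (x, y))).
- generalize (HD _ Hz); apply filter_imp; intros [u v] Hu.
  apply Derive_correct, (Hg _ Hu).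
- apply Derive_correct, (Hg _ Hz).
- apply (continuous_ext (partial_x g)); [now intros [u v] |].
  apply (Hg _ Hz).
Qed.

Lemma C1_derive_line (D : C -> Prop) (g : C -> R) (a b dx dy t : R) :
  open D -> real_class_C1 D g -> D (a + t * dx, b + t * dy) ->
  is_derive (fun s => g (a + s * dx, b + s * dy)) t
    (partial_x g (a + t * dx, b + t * dy) * dx
     + partial_y g (a + t * dx, b + t * dy) * dy).
Proof.
intros HD Hg Hz; apply is_derive_Reals.
apply (derivable_pt_lim_comp_2d (fun u v => g (u, v))
  (fun s => a + s * dx) (fun s => b + s * dy)).
- now apply (C1_differentiable D).
- apply is_derive_Reals; auto_derive; trivial; ring.
- apply is_derive_Reals; auto_derive; trivial; ring.
Qed.

(** Since [(p1 + q2)^2 - (q2 - p1)^2 = 4 p1 q2], squaring the hypothesis leaves exactly the negative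
    discriminant condition for the form. *)
Lemma quadratic_form_pos (p1 q1 p2 q2 h1 h2 : R) :
  p1 + q2 > Cmod (p2 + q1, q2 - p1) -> (h1 <> 0 \/ h2 <> 0) ->
  0 < p1 * (h1 * h1) + (p2 + q1) * (h1 * h2) + q2 * (h2 * h2).
Proof.
intros H Hh.
assert (H0 := Cmod_ge_0 (p2 + q1, q2 - p1)).
assert (Hdisc : (p2 + q1) * (p2 + q1) < 4 * (p1 * q2)).
{ assert (Hsq : Cmod (p2 + q1, q2 - p1) * Cmod (p2 + q1, q2 - p1)
    = (p2 + q1) ^ 2 + (q2 - p1) ^ 2).
  { unfold Cmod; rewrite sqrt_sqrt; [reflexivity |].
    apply Rplus_le_le_0_compat; apply pow2_ge_0. }
  nra. }
(* By [Hdisc], [p1] and [q2] have the same strict sign, and their sum is positive. *)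
assert (Hp1 : 0 < p1).
{ assert (Hs := Rle_0_sqr (p2 + q1)); unfold Rsqr in Hs.
  apply Rnot_le_lt; intros Hp1; nra. }
apply (Rmult_lt_reg_l (4 * p1)); [lra |].
rewrite Rmult_0_r.
(* Complete the square in [h1]; the scaling by [4 * p1] avoids division. *)
replace (4 * p1 * _) with
  ((2 * p1 * h1 + (p2 + q1) * h2) ^ 2
   + (4 * (p1 * q2) - (p2 + q1) * (p2 + q1)) * h2 ^ 2) by ring.
destruct (Req_dec h2 0) as [-> | Hh2].
- destruct Hh as [Hh1 | Hh2]; [| now destruct Hh2].
  assert (0 < (p1 * h1) ^ 2); [| nra].
  apply pow2_gt_0, Rmult_integral_contrapositive; split; [lra | exact Hh1].
- apply Rplus_le_lt_0_compat; [apply pow2_ge_0 |].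
  apply Rmult_lt_0_compat; [lra | now apply pow2_gt_0].
Qed.

Theorem theorem3p1 :
  forall (D : C -> Prop) (f : C -> C),
    open D -> convex D -> class_C1 D f ->
    (exists w1 w2 : C,
       (Re w1 * Im w2 <> Re w2 * Im w1)%R /\
       forall z : C, D z ->
         (Re (d_dz f z * w1 + d_dzbar f z * Cconj w1)%C
          + Im (d_dz f z * w2 + d_dzbar f z * Cconj w2)%C
          > Cmod (d_dz f z * (w2 - Ci * w1)
                  + d_dzbar f z * Cconj (w2 + Ci * w1))%C)%R) ->
    injective_on D f.
Proof.
intros D f HD Hconv [Hu Hv] [[a1 b1] [[a2 b2] [Hdet Hpos]]] [x1 y1] [x2 y2] Hz1 Hz2 Hf.
simpl in Hdet.
set (dx := x2 - x1); set (dy := y2 - y1).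
set (d := a1 * b2 - a2 * b1).
assert (Hd : d <> 0) by (unfold d; lra).
(* Cramer's rule for [h1 w1 + h2 w2 = z2 - z1], with determinant [d]. *)
set (h1 := (dx * b2 - a2 * dy) / d).
set (h2 := (a1 * dy - dx * b1) / d).
assert (Hdx : dx = h1 * a1 + h2 * a2) by (unfold h1, h2, d; field; exact Hd).
assert (Hdy : dy = h1 * b1 + h2 * b2) by (unfold h1, h2, d; field; exact Hd).
assert (Hh : (x1, y1) = (x2, y2) \/ (h1 <> 0 \/ h2 <> 0)).
{ destruct (Req_dec h1 0) as [E1 | N1]; [| tauto].
  destruct (Req_dec h2 0) as [E2 | N2]; [| tauto].
  left; rewrite E1, E2 in Hdx, Hdy; unfold dx, dy in Hdx, Hdy; f_equal; lra. }
destruct Hh as [Hz | Hh]; [exact Hz | exfalso].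
assert (Hseg : forall t, 0 <= t <= 1 -> D (x1 + t * dx, y1 + t * dy)).
{ intros t Ht; generalize (Hconv _ _ t Hz1 Hz2 Ht).
  match goal with |- D ?z -> D ?w => replace z with w; [trivial |] end.
  unfold Cplus, Cmult, RtoC, dx, dy; simpl; f_equal; ring. }
set (gam := fun t : R => (x1 + t * dx, y1 + t * dy)).
set (phi := fun t => h1 * re_part f (gam t) + h2 * im_part f (gam t)).
set (dphi := fun t =>
  h1 * (partial_x (re_part f) (gam t) * dx + partial_y (re_part f) (gam t) * dy)
  + h2 * (partial_x (im_part f) (gam t) * dx + partial_y (im_part f) (gam t) * dy)).
assert (Hphi : forall t, 0 <= t <= 1 -> is_derive phi t (dphi t)).
{ intros t Ht; apply (@is_derive_plus R_AbsRing R_NormedModule);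
    apply (is_derive_scal (fun s => _ (gam s)));
    apply (C1_derive_line D); auto. }
assert (Hdphi : forall t, 0 <= t <= 1 -> 0 < dphi t).
{ intros t Ht; unfold dphi; rewrite Hdx, Hdy.
  specialize (Hpos _ (Hseg t Ht)); fold (gam t) in Hpos.
  unfold d_dz, d_dzbar, d_dx, d_dy in Hpos.
  revert Hpos.
  generalize (partial_x (re_part f) (gam t)) (partial_y (re_part f) (gam t))
    (partial_x (im_part f) (gam t)) (partial_y (im_part f) (gam t)).
  intros ux uy vx vy Hpos.
  (* For real-linear reasons [d_dz f * w + d_dzbar f * Cconj w] is the derivative of [f] in the
     direction [w]. As [Cconj (Ci * w1) = - Ci * Cconj w1], the argument of [Cmod] is
     [(p2 + i q2) - i (p1 + i q1)], that is [(p2 + q1) + i (q2 - p1)]. *)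
  assert (Hq := quadratic_form_pos (ux * a1 + uy * b1) (vx * a1 + vy * b1)
    (ux * a2 + uy * b2) (vx * a2 + vy * b2) h1 h2).
  match goal with |- 0 < ?e => match type of Hq with _ -> _ -> 0 < ?e' =>
    replace e with e' by ring end end.
  apply Hq; [| exact Hh].
  match type of Hpos with ?l > Cmod ?z => match goal with |- ?l' > Cmod ?z' =>
    replace l' with l; [replace z' with z; [exact Hpos |] |] end end.
  - apply injective_projections; simpl; field.
  - simpl; field. }
(* The point [c] is only known to lie in the closed interval, so [Hdphi] has to cover both
   endpoints. *)
destruct (MVT_gen phi 0 1 dphi) as [c [Hc E]].
- intros t Ht; rewrite Rmin_left, Rmax_right in Ht by lra; apply Hphi; lra.
- intros t Ht; rewrite Rmin_left, Rmax_right in Ht by lra.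
  apply derivable_continuous_pt; exists (dphi t).
  now apply is_derive_Reals, Hphi.
- rewrite Rmin_left, Rmax_right in Hc by lra.
  assert (E0 : gam 0 = (x1, y1)) by (unfold gam; f_equal; ring).
  assert (E1 : gam 1 = (x2, y2)) by (unfold gam, dx, dy; f_equal; ring).
  assert (Hends : phi 0 = phi 1) by
    (unfold phi, re_part, im_part; now rewrite E0, E1, Hf).
  specialize (Hdphi c Hc); lra.
Qed.
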